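(* Each of the following monomial ideals of $\mathbb{C}[x,y,z]$ fails the WLP in degree $4$: (i) $(x^5,y^5,z^5,x^3y^2,x^3z^2,x^3yz)$; (ii) $(x^5,y^5,z^5,x^4z,x^4y,m)$, where $m$ is any monomial of degree $5$; (iii) $(x^5,y^5,z^5,x^3y^2,x^2y^3,x^2y^2z)$.
   Context: For an artinian homogeneous ideal $I$ in $R=\mathbb{C}[x,y,z]$, put $A=R/I=\bigoplus_jA_j$. $I$ fails the WLP (Weak Lefschetz Property) in degree $j$ if for every linear form $L$ the multiplication map $\times L:A_j\to A_{j+1}$ does not have maximal rank (i.e. is neither injective nor surjective). *)

(* Defs.v *)
From HB Require Import structures.
From mathcomp Require Import all_boot all_order all_algebra.
From mathcomp Require Import boolp classical_sets functions reals.
From mathcomp Require Import complex mpoly.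

Set Implicit Arguments.
Unset Strict Implicit.
Unset Printing Implicit Defensive.

Import GRing.Theory.

Local Open Scope ring_scope.
Local Open Scope quotient_scope.

Section GeneratedIdeal.
Variables (S : comNzRingType) (gs : seq S).

Definition ideal_gen : {pred S} :=
  [pred f : S | `[< exists c : 'I_(size gs) -> S,
                      f = \sum_(i < size gs) c i * gs`_i >]].

Lemma ideal_genP f :
  reflect (exists c : 'I_(size gs) -> S, f = \sum_(i < size gs) c i * gs`_i)
          (f \in ideal_gen).
Proof. exact: asboolP. Qed.

Lemma ideal_gen_zmod_closed : zmod_closed ideal_gen.
Proof.
split=> [|f g /ideal_genP[c ->] /ideal_genP[d ->]]; apply/ideal_genP.
  by exists (fun=> 0); rewrite big1 // => i _; rewrite mul0r.
exists (fun i => c i - d i); rewrite -sumrB.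
by apply: eq_bigr => i _; rewrite mulrBl.
Qed.

HB.instance Definition _ :=
  GRing.isZmodClosed.Build S ideal_gen ideal_gen_zmod_closed.

Lemma ideal_genMl a f : f \in ideal_gen -> a * f \in ideal_gen.
Proof.
move=> /ideal_genP[c ->]; apply/ideal_genP; exists (fun i => a * c i).
by rewrite mulr_sumr; apply: eq_bigr => i _; rewrite mulrA.
Qed.

(* The library's ring structure on {ideal_quot I} requires 1 \notin I, which
   fails for some gs; here the quotient may be the zero ring. *)
Definition quot_ring := {ideal_quot ideal_gen}.

HB.instance Definition _ := GRing.Zmodule.on quot_ring.
HB.instance Definition _ : EqQuotient S (Quotient.equiv ideal_gen) quot_ring :=
  EqQuotient.on quot_ring.

Definition quot_one : quot_ring := \pi_quot_ring 1.
Definition quot_mul (a b : quot_ring) : quot_ring :=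
  \pi_quot_ring (repr a * repr b).

Lemma quot_mulE f g :
  quot_mul (\pi_quot_ring f) (\pi_quot_ring g) = \pi_quot_ring (f * g).
Proof.
apply/eqP; rewrite /quot_mul -(Quotient.idealrBE ideal_gen).
set f' := repr _; set g' := repr _.
have hf : f' - f \in ideal_gen.
  by rewrite (Quotient.idealrBE ideal_gen) reprK.
have hg : g' - g \in ideal_gen.
  by rewrite (Quotient.idealrBE ideal_gen) reprK.
have -> : f' * g' - f * g = g' * (f' - f) + f * (g' - g).
  by rewrite !mulrBr ![g' * _]mulrC addrA subrK.
by apply: rpredD; apply: ideal_genMl.
Qed.

Lemma quot_mulA : associative quot_mul.
Proof.
elim/quotW=> a; elim/quotW=> b; elim/quotW=> c.
by rewrite (quot_mulE b) (quot_mulE a) (quot_mulE a) (quot_mulE _ c) mulrA.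
Qed.

Lemma quot_mulC : commutative quot_mul.
Proof. by elim/quotW=> a; elim/quotW=> b; rewrite (quot_mulE a) (quot_mulE b) mulrC. Qed.

Lemma quot_mul1 : left_id quot_one quot_mul.
Proof. by elim/quotW=> a; rewrite quot_mulE mul1r. Qed.

Lemma quot_addE f g :
  \pi_quot_ring f + \pi_quot_ring g = \pi_quot_ring (f + g).
Proof. exact: esym (Quotient.pi_add ideal_gen f g). Qed.

Lemma quot_mulDl : left_distributive quot_mul +%R.
Proof.
elim/quotW=> a; elim/quotW=> b; elim/quotW=> c.
by rewrite quot_addE (quot_mulE _ c) (quot_mulE a) (quot_mulE b) quot_addE mulrDl.
Qed.

HB.instance Definition _ := GRing.Zmodule_isComPzRing.Build quot_ring
  quot_mulA quot_mulC quot_mul1 quot_mulDl.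

End GeneratedIdeal.

Section WeakLefschetz.
Local Open Scope classical_set_scope.
Variables (K : fieldType) (n : nat).
Implicit Types (gs : seq {mpoly K[n]}) (j : nat).

(* The quotient is the direct sum of these pieces when the ideal is
   homogeneous, in particular when gs consists of monomials. *)
Definition graded_piece gs j : set (quot_ring gs) :=
  \pi_(quot_ring gs) @` [set f : {mpoly K[n]} | f \is j.-homog].

Definition mul_form gs (L : {mpoly K[n]}) (a : quot_ring gs) : quot_ring gs :=
  \pi_(quot_ring gs) L * a.

(* gs generates the (artinian homogeneous) ideal under consideration. *)
Definition fails_WLP gs j : Prop :=
  forall L : {mpoly K[n]}, L \is 1.-homog ->
    ~ set_inj (@graded_piece gs j) (@mul_form gs L) /\
    ~ set_surj (@graded_piece gs j) (@graded_piece gs j.+1) (@mul_form gs L).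

End WeakLefschetz.

(* Main.v *)
(** All generators have degree 5, so A_4 is the full space of quartics (dimension
    15) and dim A_5 >= 21 - 6 = 15; hence a single nonzero quartic f with L f in I
    rules out both injectivity and surjectivity of multiplication by L.  With
    L = a x + b y + c z, one takes f = x^3 (a x - b y - c z), so that
    L f = x^3 (a^2 x^2 - (b y + c z)^2), in case (i), f = x^4 in case (ii) and
    f = x^2 y^2 in case (iii). *)
From HB Require Import structures.
Require Import Defs.
From mathcomp Require Import all_boot all_order all_algebra.
From mathcomp Require Import boolp classical_sets functions.
From mathcomp Require Import reals complex mpoly ring zify.

Set Implicit Arguments.
Unset Strict Implicit.
Unset Printing Implicit Defensive.

Import GRing.Theory.

Local Open Scope ring_scope.
Local Open Scope quotient_scope.

(** * Homogeneous components of products *)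

Section Homogeneous.
Variables (n : nat) (K : comNzRingType).
Implicit Types (p q : {mpoly K[n]}) (d e : nat).

(** Expand [p] into monomials: each ['X_[m] * q] is homogeneous of degree [mdeg m + e], so the
    projection keeps or kills it whole. Stating the condition as a sum avoids truncated subtraction
    and covers [d < e] too. *)
Lemma pihomogMr_sum d e p q : q \is e.-homog ->
  pihomog mdeg d (p * q) =
  (\sum_(m <- msupp p | (mdeg m + e)%N == d) p@_m *: 'X_[m]) * q.
Proof.
move=> hq; rewrite {1}(mpolyE p) !mulr_suml linear_sum [RHS]big_mkcond /=.
apply: eq_bigr => m _; rewrite -!scalerAl linearZ /=.
have hm : 'X_[m] * q \is (mdeg m + e).-homog by rewrite dhomogM ?dhomogX.
case: ifPn => [/eqP<-|ne]; first by rewrite pihomog_dE.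
by rewrite (pihomog_ne0 ne) ?scaler0.
Qed.

Lemma pihomogMr d e p q : q \is e.-homog ->
  pihomog mdeg (d + e) (p * q) = pihomog mdeg d p * q.
Proof.
by move=> /pihomogMr_sum->; under eq_bigl do rewrite eqn_add2r.
Qed.

Lemma pihomogMr_lt d e p q : (d < e)%N -> q \is e.-homog ->
  pihomog mdeg d (p * q) = 0.
Proof.
move=> lt_de /pihomogMr_sum->.
by rewrite big_pred0 ?mul0r // => m; apply/eqP; lia.
Qed.

Lemma dhomog0E p : p \is 0.-homog -> p = (p@_0%MM)%:MP.
Proof.
move=> hp; apply/mpolyP => m; rewrite mcoeffC.
case: (eqVneq m 0%MM) => [->|ne]; first by rewrite mulr1.
by rewrite mulr0 (dhomog_nemf_coeff hp) // mdeg_eq0.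
Qed.

Lemma dhomog1E p : p \is 1.-homog -> p = \sum_(i < n) p@_U_(i) *: 'X_i.
Proof.
move=> hp; apply/mpolyP => m; rewrite raddf_sum /=.
have [/mdeg1P [i /eqP ->]|ne] := boolP (mdeg m == 1%N).
  rewrite (bigD1 i) //= mcoeffZ mcoeffX eqxx mulr1 big1 ?addr0 // => j ji.
  by rewrite mcoeffZ mcoeffXU (negPf ji) mulr0.
rewrite (dhomog_nemf_coeff hp ne) big1 // => i _.
rewrite mcoeffZ mcoeffX; case: eqP => [E|]; last by rewrite mulr0.
by rewrite -E mdeg1 in ne.
Qed.

End Homogeneous.

(** * Low-degree part of an ideal generated in a single degree *)

Section Ideal.
Variables (n : nat) (K : fieldType) (gs : seq {mpoly K[n]}).
Implicit Types (f g : {mpoly K[n]}).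

Lemma mem_ideal_gen g : g \in gs -> g \in ideal_gen gs.
Proof.
move=> /(nthP 0) [i lti <-]; apply/ideal_genP.
exists (fun k : 'I__ => (k == i :> nat)%:R).
rewrite (bigD1 (Ordinal lti)) //= eqxx mul1r big1 ?addr0 // => k.
by rewrite -val_eqE /= => /negPf->; rewrite mul0r.
Qed.

Lemma pi_quot_eq f g :
  (\pi_(quot_ring gs) f = \pi_(quot_ring gs) g) <-> f - g \in ideal_gen gs.
Proof. by rewrite (Quotient.idealrBE (ideal_gen gs)); split=> /eqP. Qed.

Lemma mul_form_pi (L f : {mpoly K[n]}) :
  mul_form L (\pi_(quot_ring gs) f) = \pi_(quot_ring gs) (L * f).
Proof. exact: quot_mulE. Qed.

Variable d : nat.
Hypothesis gs_homog : forall g, g \in gs -> g \is d.-homog.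

(** Projecting to a degree below [d] kills every multiple of a generator. *)
Lemma dhomog_ideal_gen_lt e f :
  (e < d)%N -> f \is e.-homog -> f \in ideal_gen gs -> f = 0.
Proof.
move=> lt_ed /pihomog_dE {2}<- /ideal_genP [c ->].
rewrite linear_sum big1 //= => i _.
by rewrite (pihomogMr_lt _ lt_ed) // gs_homog // mem_nth.
Qed.

(** In degree [d] only the constant terms of the cofactors survive. This bounds the dimension of
    that piece of the ideal by [size gs]. *)
Lemma dhomog_ideal_gen_span f :
    f \is d.-homog -> f \in ideal_gen gs ->
  exists a : 'I_(size gs) -> K, f = \sum_(i < size gs) a i *: gs`_i.
Proof.
move=> /pihomog_dE {2}<- /ideal_genP [c ->].
exists (fun i => (pihomog mdeg 0 (c i))@_0%MM).
rewrite linear_sum; apply: eq_bigr => i _ /=.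
rewrite -mul_mpolyC -dhomog0E ?pihomogP // -[in LHS](add0n d).
by rewrite pihomogMr // gs_homog // mem_nth.
Qed.

End Ideal.

(** * From a kernel element to failure of the WLP *)

Section DimensionCount.
Variables (n : nat) (K : fieldType) (j : nat) (gs : seq {mpoly K[n.+1]}).
Hypothesis gs_homog : forall g, g \in gs -> g \is j.+1.-homog.

Let U := dhomog n.+1 K j.
Let V := dhomog n.+1 K j.+1.

Lemma val_indhomog d (f : {mpoly K[n.+1]}) :
  f \is d.-homog -> \val (indhomog d f) = f.
Proof. exact: insubdK. Qed.

(** The ideal is zero in degree [j], so the class of [f] is a nonzero element of the kernel. *)
Lemma kernel_fails_injective (L f : {mpoly K[n.+1]}) :
    f \is j.-homog -> f != 0 -> L * f \in ideal_gen gs ->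
  ~ set_inj (@graded_piece _ _ gs j) (@mul_form _ _ gs L).
Proof.
move=> hf fn0 hLf inj.
suff /pi_quot_eq : \pi_(quot_ring gs) f = \pi_(quot_ring gs) 0.
  rewrite subr0 => /(dhomog_ideal_gen_lt gs_homog (ltnSn j) hf) f0.
  by rewrite f0 eqxx in fn0.
apply: inj; rewrite ?inE; [by exists f| by exists 0; rewrite //= rpred0|].
by rewrite !mul_form_pi; apply/pi_quot_eq; rewrite mulr0 subr0.
Qed.

(** The count takes place among polynomials rather than in the quotient: surjectivity means that the
    multiples of [L] and the generators together span [V]. The binomials are the dimensions of the
    forms of degree [j] and [j.+1] in [n.+1] variables. *)
Lemma kernel_fails_surjective (L f : {mpoly K[n.+1]}) :
    (size gs + 'C(j + n, j) <= 'C(j.+1 + n, j.+1))%N ->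
    L \is 1.-homog ->
    f \is j.-homog -> f != 0 -> L * f \in ideal_gen gs ->
  ~ set_surj (@graded_piece _ _ gs j) (@graded_piece _ _ gs j.+1)
             (@mul_form _ _ gs L).
Proof.
move=> le_dim hL hf fn0 hLf surj.
have homL (p : U) : L * \val p \is j.+1.-homog.
  exact: dhomogM hL (dhomog_is_dhomog p).
(* [indhomog] falls back to a default on inputs of the wrong degree; [homL] rules this out. *)
pose mL (p : U) : V := indhomog j.+1 (L * \val p).
have mL_lin : linear mL.
  move=> a p q; apply: val_inj; rewrite linearP /= !val_indhomog //.
  by rewrite linearP /= mulrDr scalerAr.
pose mL_isLinear := GRing.isLinear.Build K U V *:%R mL mL_lin.
pose mL' : {linear U -> V} := HB.pack mL mL_isLinear.
pose h := linfun mL'.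
have hE p : \val (h p) = L * \val p by rewrite lfunE /= val_indhomog.
pose X := [seq indhomog j.+1 g : V | g <- gs].
have hX (v : V) : \val v \in ideal_gen gs -> v \in <<X>>%VS.
  move=> /(dhomog_ideal_gen_span gs_homog (dhomog_is_dhomog v)) [a va].
  have -> : v = \sum_(i < size gs) a i *: indhomog j.+1 gs`_i.
    apply: val_inj; rewrite va raddf_sum /=; apply: eq_bigr => i _.
    by rewrite -[in LHS](val_indhomog (gs_homog (mem_nth 0 (ltn_ord i)))).
  apply: memv_suml => i _; apply/memvZ/memv_span/map_f.
  exact: mem_nth.
(* Surjectivity yields [p] with [L * p] congruent to [v]; then [v] is [h p'] minus an element of the
   ideal of degree [j.+1], which [hX] puts in the span. *)
have full : (limg h + <<X>> = {:V})%VS.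
  apply/eqP; rewrite eqEsubv subvf /=; apply/subvP => v _.
  have [|_ [p hp <-]] := surj (\pi_(quot_ring gs) (\val v)).
    by exists (\val v) => //=; apply: dhomog_is_dhomog.
  rewrite mul_form_pi => /pi_quot_eq hLp.
  have [p' p'E] : exists p' : U, \val p' = p.
    by exists (indhomog j p); apply: val_indhomog.
  rewrite -(subKr (h p') v); apply: memv_add; first exact/memv_img/memvf.
  by rewrite memvN; apply: hX; rewrite raddfB /= hE p'E.
have [f' f'E] : exists f' : U, \val f' = f.
  by exists (indhomog j f); apply: val_indhomog.
have dim_X : (\dim <<X>> <= size gs)%N.
  by rewrite (leq_trans (dim_span _)) ?size_map.
have dim_U : \dim {:U} = 'C(j + n, j) by rewrite dimvf.
have dim_V : \dim {:V} = 'C(j.+1 + n, j.+1) by rewrite dimvf.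
(* Equality must hold throughout dim V <= dim (limg h) + dim <<X>> <= dim V, so h
   is injective and its image meets <<X>> trivially; but h f' lies in both. *)
have := limg_ker_dim h fullv; rewrite capfv dim_U => dim_h.
have := dimv_add_leqif (limg h) <<X>>; rewrite full dim_V => -[le_sum eq_sum].
have ker0 : lker h = 0%VS by apply/eqP; rewrite -dimv_eq0; lia.
have /esym : ('C(j.+1 + n, j.+1) == \dim (limg h) + \dim <<X>>)%N = true by lia.
rewrite eq_sum => /esym /subvP /(_ (h f')).
rewrite memv_cap memv_img ?memvf //= hX ?hE ?f'E // => /(_ isT).
rewrite memv0 -memv_ker ker0 memv0 => /eqP f'0.
by rewrite -f'E f'0 raddf0 eqxx in fn0.
Qed.

(** The witness [f] may depend on [L], as it does in case (i); the form [L = 0] is included. *)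
Lemma fails_WLP_kernel :
    (size gs + 'C(j + n, j) <= 'C(j.+1 + n, j.+1))%N ->
    (forall L : {mpoly K[n.+1]}, L \is 1.-homog ->
       exists f, [/\ f \is j.-homog, f != 0 & L * f \in ideal_gen gs]) ->
  fails_WLP gs j.
Proof.
move=> le_dim ker L hL; have [f [hf fn0 hLf]] := ker L hL; split.
  exact: kernel_fails_injective hf fn0 hLf.
exact: kernel_fails_surjective le_dim hL hf fn0 hLf.
Qed.

End DimensionCount.

(** * The three families of monomial ideals, over any field *)

Section ThreeVariables.
Variable K : fieldType.
Let x : {mpoly K[3]} := 'X_(inord 0).
Let y : {mpoly K[3]} := 'X_(inord 1).
Let z : {mpoly K[3]} := 'X_(inord 2).

Lemma dhomogXU i : ('X_i : {mpoly K[3]}) \is 1.-homog.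
Proof. by rewrite dhomogX; apply/eqP/mdeg1. Qed.

Lemma dhomogXUn i e : ('X_i : {mpoly K[3]}) ^+ e \is e.-homog.
Proof. by rewrite -[X in X.-homog]mul1n; apply/dhomogMn/dhomogXU. Qed.

Lemma dhomogXUnM d e i j :
  ('X_i ^+ d * 'X_j ^+ e : {mpoly K[3]}) \is (d + e).-homog.
Proof. by rewrite dhomogM ?dhomogXUn. Qed.

Lemma dhomog1_xyz (L : {mpoly K[3]}) : L \is 1.-homog ->
  L = L@_U_(inord 0) *: x + L@_U_(inord 1) *: y + L@_U_(inord 2) *: z.
Proof.
move=> /dhomog1E {1}->; rewrite !big_ord_recl big_ord0 addr0 addrA.
(* [big_ord_recl] indexes the terms by iterated [lift]; these equations return to the [inord]
   indices of [x], [y], [z]. *)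
have i1 : lift ord0 ord0 = inord 1 :> 'I_3 by apply: val_inj; rewrite /= inordK.
have i2 : lift ord0 (lift ord0 ord0) = inord 2 :> 'I_3.
  by apply: val_inj; rewrite /= inordK.
have i0 : ord0 = inord 0 :> 'I_3 by apply: val_inj; rewrite /= inordK.
by rewrite i2 i1 i0.
Qed.

Lemma monomial_neq0 (m : 'X_{1..3}) : 'X_[m] != 0 :> {mpoly K[3]}.
Proof. by rewrite -msize_poly_eq0 msizeX. Qed.

Lemma fails_WLP_i :
  fails_WLP [:: x ^+ 5; y ^+ 5; z ^+ 5; x ^+ 3 * y ^+ 2; x ^+ 3 * z ^+ 2;
                x ^+ 3 * y * z] 4.
Proof.
(* With [n = 2] and [j = 4] the size condition is 6 + 15 <= 21, an equality. *)
apply: fails_WLP_kernel => //.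
  apply/allP; rewrite /= !dhomogXUn !(dhomogXUnM 3 2).
  by rewrite (dhomogM (d := 4)) ?dhomogXU // (dhomogXUnM 3 1).
move=> L hL; have L_xyz := dhomog1_xyz hL.
set a := L@__ in L_xyz.
(* The general witness vanishes when [L = 0], so that case takes another quartic. *)
have [L0|Ln0] := eqVneq L 0.
  exists (x ^+ 4); split; [exact: dhomogXUn| |by rewrite L0 mul0r rpred0].
  by rewrite expf_neq0 ?monomial_neq0.
(* This is a x - b y - c z, written so that it is visibly nonzero. *)
exists (x ^+ 3 * (a *: x *+ 2 - L)); split.
- rewrite (dhomogM (d := 3) (e := 1)) ?dhomogXUn // rpredB //.
  by rewrite rpredMn ?rpredZ ?dhomogXU.
- rewrite mulf_neq0 ?expf_neq0 ?monomial_neq0 //; apply/eqP => q0.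
  (* The coefficient of [x] in the second factor is [2a - a = a], in any characteristic; once it is
     zero, the factor is [- L]. *)
  have a0 : a = 0.
    have := congr1 (mcoeff U_(inord 0)) q0.
    rewrite mcoeffB mcoeffMn mcoeffZ mcoeffXU eqxx mulr1 mcoeff0 -/a.
    by rewrite mulr2n addrK.
  move: q0 Ln0; rewrite a0 scale0r mul0rn sub0r => /eqP.
  by rewrite oppr_eq0 => ->.
set b := L@__ in L_xyz; set c := L@__ in L_xyz.
(* Difference of squares: the generator [x ^+ 3 * y * z] absorbs the cross term of the square of
   [b y + c z]. *)
have -> : L * (x ^+ 3 * (a *: x *+ 2 - L)) =
    (a ^+ 2) *: x ^+ 5 - (b ^+ 2) *: (x ^+ 3 * y ^+ 2)
    - (c ^+ 2) *: (x ^+ 3 * z ^+ 2) - (b * c *+ 2) *: (x ^+ 3 * y * z).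
  by rewrite L_xyz -!mul_mpolyC !(rmorphXn, rmorphM, rmorphMn) /=; ring.
rewrite -!mul_mpolyC !rpredB // ideal_genMl // mem_ideal_gen //.
all: by rewrite !inE eqxx ?orbT.
Qed.

(** The generators [x ^+ 5], [x ^+ 4 * y], [x ^+ 4 * z] already send [L * x ^+ 4] into the ideal.
    The monomial [m] may repeat another generator, since the count only uses the length of the
    list. *)
Lemma fails_WLP_ii (m : 'X_{1..3}) : mdeg m = 5%N ->
  fails_WLP [:: x ^+ 5; y ^+ 5; z ^+ 5; x ^+ 4 * z; x ^+ 4 * y; 'X_[m]] 4.
Proof.
move=> m5; apply: fails_WLP_kernel => //.
  apply/allP; rewrite /= !dhomogXUn !(dhomogXUnM 4 1) dhomogX /=.
  by rewrite m5.
move=> L /dhomog1_xyz ->; exists (x ^+ 4); split; first exact: dhomogXUn.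
  by rewrite expf_neq0 ?monomial_neq0.
rewrite !mulrDl -!scalerAl -!(mulrC (x ^+ 4)) -exprSr.
rewrite -!mul_mpolyC !rpredD // ideal_genMl // mem_ideal_gen //.
all: by rewrite !inE eqxx ?orbT.
Qed.

(** The products of [x ^+ 2 * y ^+ 2] with [x], [y], [z] are exactly the last three generators. *)
Lemma fails_WLP_iii :
  fails_WLP [:: x ^+ 5; y ^+ 5; z ^+ 5; x ^+ 3 * y ^+ 2; x ^+ 2 * y ^+ 3;
                x ^+ 2 * y ^+ 2 * z] 4.
Proof.
apply: fails_WLP_kernel => //.
  apply/allP; rewrite /= !dhomogXUn (dhomogXUnM 3 2) (dhomogXUnM 2 3).
  by rewrite (dhomogM (d := 4)) ?dhomogXU // (dhomogXUnM 2 2).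
move=> L /dhomog1_xyz ->; exists (x ^+ 2 * y ^+ 2); split.
- exact: (dhomogXUnM 2 2).
- by rewrite mulf_neq0 ?expf_neq0 ?monomial_neq0.
rewrite !mulrDl -!scalerAl -!(mulrC (x ^+ 2 * y ^+ 2)).
have -> : x ^+ 2 * y ^+ 2 * x = x ^+ 3 * y ^+ 2 by ring.
have -> : x ^+ 2 * y ^+ 2 * y = x ^+ 2 * y ^+ 3 by ring.
rewrite -!mul_mpolyC !rpredD // ideal_genMl // mem_ideal_gen //.
all: by rewrite !inE eqxx ?orbT.
Qed.

End ThreeVariables.

Theorem proposition6p2 (R : realType) :
  let x : {mpoly (complex R)[3]} := 'X_(inord 0) in
  let y : {mpoly (complex R)[3]} := 'X_(inord 1) in
  let z : {mpoly (complex R)[3]} := 'X_(inord 2) in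
  [/\ fails_WLP [:: x ^+ 5; y ^+ 5; z ^+ 5; x ^+ 3 * y ^+ 2; x ^+ 3 * z ^+ 2;
                    x ^+ 3 * y * z] 4,
      forall m : 'X_{1..3}, mdeg m = 5%N ->
        fails_WLP [:: x ^+ 5; y ^+ 5; z ^+ 5; x ^+ 4 * z; x ^+ 4 * y; 'X_[m]] 4
    & fails_WLP [:: x ^+ 5; y ^+ 5; z ^+ 5; x ^+ 3 * y ^+ 2; x ^+ 2 * y ^+ 3;
                    x ^+ 2 * y ^+ 2 * z] 4].
Proof.
split; [exact: fails_WLP_i | exact: fails_WLP_ii | exact: fails_WLP_iii].
Qed.
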